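(* Define $g_2(n)$ by $$\sum_{n=0}^{\infty}g_2(n)q^n=\frac{(-q;q)_\infty}{(q;q)_\infty}\,\phi(q^2)=\frac{\ell_4^5}{\ell_1^2\ell_2\ell_8^2}.$$ Then for all integers $\alpha\ge0$: (i) for every prime $p\ge3$ and every $1\le j\le p-1$, $$\sum_{n=0}^{\infty} g_2\!\left(16p^{2\alpha}n+2p^{2\alpha}\right)q^n\equiv 2\psi(q)\pmod 4,\qquad g_2\!\left(16p^{2\alpha+2}n+16p^{2\alpha+1}j+2p^{2\alpha+2}\right)\equiv0\pmod 4\ \text{ for all } n\ge0;$$ (ii) for every prime $p\ge5$ with $\left(\frac{-8}{p}\right)=-1$ and every $1\le j\le p-1$, $$\sum_{n=0}^{\infty} g_2\!\left(8p^{2\alpha}n+3p^{2\alpha}\right)q^n\equiv 4\ell_1\ell_8\pmod 8,\qquad g_2\!\left(8p^{2\alpha+2}n+8p^{2\alpha+1}j+3p^{2\alpha+2}\right)\equiv0\pmod 8\ \text{ for all } n\ge0.$$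
   Context: $(A;q)_\infty=\prod_{j\ge0}(1-Aq^j)$ and $\ell_n=(q^n;q^n)_\infty$ for integers $n\ge1$. $\phi(q)=\sum_{m\in\mathbb Z}q^{m^2}$ and $\psi(q)=\sum_{m\ge0}q^{m(m+1)/2}=\ell_2^2/\ell_1$. A congruence $A(q)\equiv B(q)\pmod M$ between power series with integer coefficients means that corresponding coefficients are congruent modulo $M$. $\left(\frac{\cdot}{p}\right)$ is the Legendre symbol. *)

(* Defs.v *)
From HB Require Import structures.
From mathcomp Require Import all_boot all_order all_algebra.
Set Implicit Arguments. Unset Strict Implicit. Unset Printing Implicit Defensive.
Import Order.TTheory GRing.Theory Num.Theory.
Local Open Scope ring_scope.

(* Truncations of q-products as integer polynomials.  For a fixed degree N,
   the coefficient of q^N in any of the infinite products below only depends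
   on the factors (1 - q^(k j)) with k j <= N, and 1/(1-q^m) agrees with
   sum_{i<=N} q^(m i) modulo q^(N+1). *)

Definition ell_trunc (k N : nat) : {poly int} :=
  \prod_(1 <= j < N.+1) (1 - 'X^(k * j)).

Definition geom_trunc (m N : nat) : {poly int} :=
  \sum_(i < N.+1) 'X^(m * i).

Definition ell_inv_trunc (k N : nat) : {poly int} :=
  \prod_(1 <= j < N.+1) geom_trunc (k * j) N.

Definition g2 (n : nat) : int :=
  (ell_trunc 4 n ^+ 5 * ell_inv_trunc 1 n ^+ 2 * ell_inv_trunc 2 n
     * ell_inv_trunc 8 n ^+ 2)`_n.

Definition psi_coef (n : nat) : int :=
  (\sum_(m < n.+1) ((m * m.+1)./2 == n)%N)%:Z.

Definition ell1ell8_coef (n : nat) : int :=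
  (ell_trunc 1 n * ell_trunc 8 n)`_n.

Definition legendre (a : int) (p : nat) : int :=
  if (p%:Z %| a)%Z then 0
  else if [exists x : 'I_p, ((x%:Z ^+ 2 - a) %% p%:Z)%Z == 0] then 1 else -1.

(* Main.v *)
Require Import Defs.
From Stdlib Require Import Setoid Morphisms.
From mathcomp Require Import all_boot all_order all_algebra.
From mathcomp Require Import ring zify.
Import Order.TTheory GRing.Theory Num.Theory.
Local Open Scope ring_scope.

(** Gauss's identity phi(-q) = l_1^2 / l_2 turns the generating function of g_2
    into phi(-q^4)^2 / (phi(-q) phi(-q^2)).  Writing phi(-q) = 1 + 2 S(q), one
    has phi(-q)^4 = 1 modulo 8, so that the quotient becomes a polynomial
    in S(q), S(q^2), S(q^4).  On the exponents N = 2 (mod 4) only 2 S(q^2)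
    survives modulo 4, and it detects whether N / 2 is a square; on N = 3 (mod 8)
    only 4 S(q) S(q^2) survives modulo 8, and it counts the representations
    N = x^2 + 2 y^2.  Both counts are unchanged when N is multiplied by p^2
    (for the second one, p is inert in Q(sqrt(-2))) and vanish when p divides N
    exactly to an odd power.  Finally Gauss's psi(q) = l_2^2 / l_1 gives
    psi(q) = l_1^3 modulo 2, hence l_1 l_8 = l_1^9 = psi(q) psi(q^2) modulo 2,
    which counts the representations of 8n + 3 by x^2 + 2 y^2. *)

(** * Finite forms of Gauss's identities for phi and psi *)

Section Shanks.
Variable R : comNzRingType.
Implicit Types (q y z : R) (c : nat -> R).

(* Both identities of Gauss below follow D. Shanks: a finite form of the sum
   has terms [c] obeying the same first-order recurrence, with [z = -1] for phi
   and [z = q] (in base [q ^+ 2]) for psi. *)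
Lemma shanks_telescope q y z c m :
  (forall s, (s < m)%N ->
     c s.+1 * (1 - q ^+ s.+1) = y * c s * (1 - z * q ^+ s)) ->
  \sum_(s < m) c s * ((1 - y * z) * q ^+ s)
    = (1 - y) * \sum_(s < m) c s + c m * (1 - q ^+ m).
Proof.
elim: m => [|m IHm] cP; first by rewrite !big_ord0; ring.
rewrite !big_ord_recr /= IHm => [|s lt_sm]; last by rewrite cP // ltnW.
by rewrite cP //; ring.
Qed.

(* Half of [phi(-q) - 1], truncated. *)
Definition theta_sum q n : R := \sum_(1 <= j < n.+1) (-1) ^+ j * q ^+ (j ^ 2).

Definition theta_term q n s : R :=
  (-1) ^+ s * (\prod_(0 <= k < s) (1 + q ^+ k)
      * \prod_(s.+1 <= k < n.+1) (1 - q ^+ k)) * q ^+ (s * n.+1).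

(** Induction on [n]: passing to [n + 1] multiplies the term of index [s] by [(1 - q^(n+1)) q^s].
    With [y = -q^(n+1)] and [z = -1] the first factor is [1 - y z], so the telescoping applies, and
    [1 - y] is the new factor on the left. *)
Lemma theta_finite q n :
  \prod_(1 <= k < n.+1) (1 + q ^+ k) * (1 + 2 * theta_sum q n)
  = \sum_(s < n.+1) theta_term q n s.
Proof.
elim: n => [|n IHn].
  by rewrite /theta_sum big_ord1 /theta_term !big_geq // mul0n; ring.
pose c := theta_term q n.
have cP s : (s < n)%N ->
    c s.+1 * (1 - q ^+ s.+1) = - q ^+ n.+1 * c s * (1 - -1 * q ^+ s).
  move=> lt_sn; rewrite /c /theta_term big_nat_recr //=.
  rewrite [\prod_(s.+1 <= k < n.+1) _]big_ltn //.
  by rewrite mulSn exprD (exprS _ s); ring.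
have := shanks_telescope q (- q ^+ n.+1) (-1) c n cP.
rewrite mulrNN mulr1 => tele.
rewrite /theta_sum (big_nat_recr n.+1) // (big_nat_recr n.+1 1) //= -/(theta_sum q n).
have -> (P t u v : R) : P * u * (1 + 2 * (t + v)) = P * (1 + 2 * t) * u + 2 * P * (u * v).
  ring.
rewrite IHn big_ord_recr -/c /= [RHS]big_ord_recr /=.
under [X in _ = X + _]eq_bigr => s _.
  have -> : theta_term q n.+1 s = c s * ((1 - q ^+ n.+1) * q ^+ s).
    rewrite /c /theta_term big_nat_recr //=.
    by rewrite (mulnS s n.+1) exprD; ring.
  over.
rewrite big_ord_recr /= tele /c /theta_term.
rewrite [\prod_(n.+1 <= k < n.+1) _]big_geq // [\prod_(n.+2 <= k < n.+2) _]big_geq // !mulr1.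
(* The product from [k = 0] starts with [1 + q^0 = 2], which absorbs the factor 2 of the new
   summand. *)
have D2 : 2 * \prod_(1 <= k < n.+1) (1 + q ^+ k)
    = \prod_(0 <= k < n) (1 + q ^+ k) * (1 + q ^+ n).
  by rewrite -big_nat_recr // [RHS]big_ltn // expr0.
rewrite D2 big_nat_recr //=.
rewrite (_ : n.+1 ^ 2 = n * n.+1 + n.+1)%N; last by lia.
rewrite (_ : n.+1 * n.+2 = n * n.+1 + n.+1 + n.+1)%N; last by lia.
rewrite !exprD !(exprS _ n).
move: (\sum_(s < n) _) => C. move: (q ^+ (n * n.+1)) => w.
by move: (q ^+ n) => x; ring.
Qed.

Definition psi_sum q n : R := \sum_(0 <= m < n) q ^+ (m * m.+1)./2.

Definition psi_term q n s : R :=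
  (\prod_(0 <= k < s) (1 - q ^+ k.*2.+1)
      * \prod_(s.+1 <= k < n.+1) (1 - q ^+ k.*2)) * q ^+ (s * n.*2.+1).

(** Same induction in base [q^2], with [y = q^(2n+1)] and [z = q]. Each step adds one odd factor
    [1 - y] on the left and two triangular exponents to the sum. *)
Lemma psi_finite q n :
  \prod_(0 <= k < n) (1 - q ^+ k.*2.+1) * psi_sum q n.*2
  = \sum_(s < n) psi_term q n s.
Proof.
elim: n => [|n IHn].
  by rewrite /psi_sum big_ord0 !big_geq // mulr0.
pose c := psi_term q n.
have cP s : (s < n)%N ->
    c s.+1 * (1 - (q ^+ 2) ^+ s.+1) = q ^+ n.*2.+1 * c s * (1 - q * (q ^+ 2) ^+ s).
  move=> lt_sn; rewrite /c /psi_term big_nat_recr //=.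
  rewrite [\prod_(s.+1 <= k < n.+1) _]big_ltn // -!exprM -exprS !mul2n.
  by rewrite mulSn exprD; ring.
have := shanks_telescope (q ^+ 2) (q ^+ n.*2.+1) q c n cP.
rewrite -exprSr => tele.
rewrite /psi_sum doubleS !(big_nat_recr _ 0) // -/(psi_sum q n.*2).
have -> (P u t v w : R) : P * u * (t + v + w) = P * t * u + P * (u * (v + w)).
  ring.
rewrite IHn -/c.
rewrite [RHS]big_ord_recr.
under [X in _ = X + _]eq_bigr => s _.
  have -> : psi_term q n.+1 s = c s * ((1 - q ^+ n.*2.+2) * (q ^+ 2) ^+ s).
    rewrite /c /psi_term big_nat_recr /=; last by rewrite ltnS ltnW.
    rewrite -exprM mul2n (_ : s * n.+1.*2.+1 = s * n.*2.+1 + s.*2)%N; last by lia.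
    by rewrite exprD; ring.
  over.
rewrite tele /c /psi_term [\prod_(n.+1 <= k < n.+1) _]big_geq // mulr1 big_nat1.
rewrite (_ : (n.*2 * n.*2.+1)./2 = n * n.*2.+1)%N; last by lia.
rewrite (_ : (n.*2.+1 * n.*2.+2)./2 = n * n.*2.+1 + n.*2.+1)%N; last by nia.
rewrite (_ : n * n.+1.*2.+1 = n * n.*2.+1 + n.*2)%N; last by lia.
rewrite -exprM mul2n doubleS !exprD !(exprS _ n.*2.+1) !(exprS _ n.*2).
move: (\sum_(s < n) _) => C. move: (q ^+ (n * n.*2.+1)) => w.
by move: (q ^+ n.*2) => x; ring.
Qed.
End Shanks.

(** * Calculus of truncated congruences *)

(* Congruence modulo the ideal (M, X^n): power series modulo [M], truncated. *)
Definition eqm (M n : nat) (p q : {poly int}) : Prop :=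
  exists r s, p = q + M%:R * r + 'X^n * s.

Section Eqm.
Variables M n : nat.
Implicit Types p q : {poly int}.

Lemma eqm_refl p : eqm M n p p.
Proof. by exists 0, 0; rewrite !mulr0 !addr0. Qed.

Lemma eqm_sym p q : eqm M n p q -> eqm M n q p.
Proof. by move=> [r [s ->]]; exists (- r), (- s); ring. Qed.

Lemma eqm_trans p q u : eqm M n p q -> eqm M n q u -> eqm M n p u.
Proof. by move=> [r [s ->]] [r' [s' ->]]; exists (r + r'), (s + s'); ring. Qed.

Lemma eqmD p p' q q' : eqm M n p p' -> eqm M n q q' -> eqm M n (p + q) (p' + q').
Proof. by move=> [r [s ->]] [r' [s' ->]]; exists (r + r'), (s + s'); ring. Qed.

Lemma eqmM p p' q q' : eqm M n p p' -> eqm M n q q' -> eqm M n (p * q) (p' * q').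
Proof.
move=> [r [s ->]] [r' [s' ->]].
by exists (r * q' + p' * r' + M%:R * r * r'),
  (s * (q' + M%:R * r') + (p' + M%:R * r) * s' + 'X^n * s * s'); ring.
Qed.

Lemma eqmX k p p' : eqm M n p p' -> eqm M n (p ^+ k) (p' ^+ k).
Proof.
by move=> e; elim: k => [|k IH]; [exact: eqm_refl | rewrite !exprS; exact: eqmM].
Qed.

Lemma eqm_coef p q i : eqm M n p q -> (i < n)%N -> (p`_i = q`_i %[mod M])%Z.
Proof.
move=> [r [s ->]] lt_in; rewrite !coefD coefXnM lt_in addr0.
by rewrite mulr_natl coefMn -mulr_natr natz addrC modzMDl.
Qed.

Lemma eqm_prod1 a b (F : nat -> {poly int}) :
  (forall i, (a <= i < b)%N -> eqm M n (F i) 1) ->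
  eqm M n (\prod_(a <= i < b) F i) 1.
Proof.
move=> F1; rewrite big_nat_cond; elim/big_rec: _ => [|i p /andP[/F1 Fi _] p1].
  exact: eqm_refl.
by rewrite -[Y in eqm _ _ _ Y]mulr1; apply: eqmM.
Qed.

End Eqm.

#[local] Instance eqm_equiv M n : Equivalence (eqm M n).
Proof. split; [exact: eqm_refl|exact: eqm_sym|exact: eqm_trans]. Qed.
#[local] Instance eqmD_proper M n : Proper (eqm M n ==> eqm M n ==> eqm M n)
  (@GRing.add {poly int}).
Proof. by move=> ? ? ? ? ? ?; apply: eqmD. Qed.
#[local] Instance eqmM_proper M n : Proper (eqm M n ==> eqm M n ==> eqm M n)
  (@GRing.mul {poly int}).
Proof. by move=> ? ? ? ? ? ?; apply: eqmM. Qed.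
#[local] Instance eqmX_proper M n : Proper (eqm M n ==> eq ==> eqm M n) (@GRing.exp {poly int}).
Proof. by move=> ? ? ? ? ? <-; apply: eqmX. Qed.

(** Modulus [0] encodes exact equality up to truncation: product identities are proved there and
    reduced modulo 2 or 8 afterwards. *)
Lemma eqm0 M n p q : eqm 0 n p q -> eqm M n p q.
Proof. by move=> [r [s ->]]; exists 0, s; rewrite mul0r mulr0. Qed.

Lemma eqmXn M n m p : (n <= m)%N -> eqm M n ('X^m * p) 0.
Proof. by move=> /subnKC <-; exists 0, ('X^(m - n) * p); rewrite mulr0 !add0r mulrA -exprD. Qed.

Lemma eqm_one_subXn M n m : (n <= m)%N -> eqm M n (1 - 'X^m) 1.
Proof. by move=> /subnKC <-; exists 0, (- 'X^(m - n)); rewrite exprD; ring. Qed.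

(** * Gauss's identities for truncated products *)

Lemma ell_trunc_widen d N m : (0 < d)%N -> (N < m)%N ->
  eqm 0 N.+1 (\prod_(1 <= k < m) (1 - 'X^(d * k))) (ell_trunc d N).
Proof.
move=> d_gt0 lt_Nm; rewrite (big_cat_nat (n := N.+1)) //=.
rewrite -[Y in eqm _ _ _ Y]mulr1; apply: eqmM; first exact: eqm_refl.
apply: eqm_prod1 => i /andP[lt_Ni _]; apply: eqm_one_subXn.
by apply: leq_trans lt_Ni _; rewrite leq_pmull.
Qed.

Lemma ell_mul_inv d N : (0 < d)%N -> eqm 0 N.+1 (ell_trunc d N * ell_inv_trunc d N) 1.
Proof.
move=> d_gt0; rewrite /ell_trunc /ell_inv_trunc -big_split /=.
apply: eqm_prod1 => i /andP[i_gt0 _].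
rewrite /geom_trunc; under eq_bigr do rewrite exprM.
rewrite -opprB mulNr -subrX1 opprB -exprM; apply: eqm_one_subXn.
by rewrite leq_pmull // muln_gt0 d_gt0.
Qed.

(** In the finite identity at [q = X^d], terms with [s >= 1] carry [X^(d s (N+1))] and vanish under
    truncation; the term [s = 0] is [ell_trunc d N]. *)
Lemma ell_theta d N : (0 < d)%N ->
  eqm 0 N.+1 (ell_trunc (2 * d) N * (1 + 2 * theta_sum _ 'X^d N)) (ell_trunc d N ^+ 2).
Proof.
move=> d_gt0.
have -> : ell_trunc (2 * d) N
    = ell_trunc d N * \prod_(1 <= k < N.+1) (1 + 'X^d ^+ k).
  rewrite /ell_trunc -big_split; apply: eq_bigr => k _ /=.
  by rewrite -exprM -mulnA [(2 * _)%N]mulnC exprM; ring.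
rewrite -mulrA theta_finite expr2; apply: eqmM; first exact: eqm_refl.
rewrite big_ord_recl -[Y in eqm _ _ _ Y]addr0; apply: eqmD.
  rewrite /theta_term big_geq // mul0n !mul1r expr0 mulr1.
  rewrite /ell_trunc; under eq_bigr do rewrite -exprM.
  exact: eqm_refl.
elim/big_rec: _ => [|i p _ p0]; first exact: eqm_refl.
rewrite -[Y in eqm _ _ _ Y]addr0; apply: eqmD => //.
rewrite /theta_term -exprM mulrC; apply: eqmXn.
by rewrite mulnA leq_pmull // muln_gt0 d_gt0.
Qed.

(** Here [D] and [E] collect the odd and even factors, so [D * E] truncates to [ell_trunc d N]. Only
    the term [s = 0] of the finite identity survives, and it is [E] itself. *)
Lemma ell_psi d N : (0 < d)%N ->
  eqm 0 N.+1 (ell_trunc d N * psi_sum _ 'X^d N.+1.*2) (ell_trunc (2 * d) N ^+ 2).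
Proof.
move=> d_gt0.
pose E := \prod_(1 <= k < N.+2) (1 - ('X^d : {poly int}) ^+ k.*2).
have EE : eqm 0 N.+1 E (ell_trunc (2 * d) N).
  have -> : E = \prod_(1 <= k < N.+2) (1 - 'X^(2 * d * k)).
    by apply: eq_bigr => k _; rewrite -exprM -mul2n mulnCA mulnA.
  by apply: ell_trunc_widen; rewrite ?muln_gt0.
pose D := \prod_(0 <= k < N.+1) (1 - ('X^d : {poly int}) ^+ k.*2.+1).
have DE : eqm 0 N.+1 (D * E) (ell_trunc d N).
  have -> : D * E = \prod_(1 <= k < N.+1.*2.+1) (1 - 'X^(d * k)).
    rewrite /D /E; elim: (N.+1) => [|m IHm]; first by rewrite !big_geq // mulr1.
    rewrite doubleS !(big_nat_recr m.+1) //= (big_nat_recr m) //=.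
    rewrite (big_nat_recr m.*2.+2) // (big_nat_recr m.*2.+1) //= -IHm.
    by rewrite -!exprM doubleS; ring.
  by apply: ell_trunc_widen => //; rewrite -addnn; lia.
rewrite -DE mulrAC psi_finite expr2; apply: eqmM => //; rewrite -EE.
rewrite big_ord_recl -[Y in eqm _ _ _ Y]addr0; apply: eqmD.
  by rewrite /psi_term big_geq // mul0n !mul1r expr0 mulr1; exact: eqm_refl.
elim/big_rec: _ => [|i p _ p0]; first exact: eqm_refl.
rewrite -[Y in eqm _ _ _ Y]addr0; apply: eqmD => //.
rewrite /psi_term -exprM mulrC; apply: eqmXn.
rewrite mulnA; apply: leq_trans (_ : N.+1.*2.+1 <= _)%N; first by lia.
by rewrite leq_pmull // muln_gt0 d_gt0.
Qed.

(** * The generating function of g_2 modulo 8 *)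

Definition theta_half N d : {poly int} := theta_sum _ 'X^d N.

Definition g2_trunc N : {poly int} :=
  ell_trunc 4 N ^+ 5 * ell_inv_trunc 1 N ^+ 2 * ell_inv_trunc 2 N
    * ell_inv_trunc 8 N ^+ 2.

(** [F d] is [phi(-q^d) = l_d^2 / l_(2d)], whence [F 4 ^+ 2 / (F 1 * F 2) = l_4^5 / (l_1^2 l_2
    l_8^2)]; the denominator is cleared. *)
Lemma g2_theta N :
  let F d := 1 + 2 * theta_half N d in
  eqm 0 N.+1 (g2_trunc N * (F 1%N * F 2)) (F 4 ^+ 2).
Proof.
move=> F; rewrite /g2_trunc.
have I1 := @ell_mul_inv 1 N isT; have I2 := @ell_mul_inv 2 N isT.
have I4 := @ell_mul_inv 4 N isT; have I8 := @ell_mul_inv 8 N isT.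
have T1 : eqm 0 N.+1 (ell_trunc 2 N * F 1%N) (ell_trunc 1 N ^+ 2).
  exact: (@ell_theta 1 N isT).
have T2 : eqm 0 N.+1 (ell_trunc 4 N * F 2) (ell_trunc 2 N ^+ 2).
  exact: (@ell_theta 2 N isT).
have T4 : eqm 0 N.+1 (ell_trunc 8 N * F 4) (ell_trunc 4 N ^+ 2).
  exact: (@ell_theta 4 N isT).
move: (ell_trunc 1 N) (ell_trunc 2 N) (ell_trunc 4 N) (ell_trunc 8 N) I1 I2 I4 I8 T1 T2 T4.
move: (ell_inv_trunc 1 N) (ell_inv_trunc 2 N) (ell_inv_trunc 4 N) (ell_inv_trunc 8 N).
move=> J1 J2 J4 J8 L1 L2 L4 L8 I1 I2 I4 I8 T1 T2 T4.
have e1 : eqm 0 N.+1 (F 1%N) (L1 ^+ 2 * J2).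
  by rewrite -T1 mulrAC I2 mul1r; exact: eqm_refl.
have e2 : eqm 0 N.+1 (F 2) (L2 ^+ 2 * J4).
  by rewrite -T2 mulrAC I4 mul1r; exact: eqm_refl.
have e4 : eqm 0 N.+1 (F 4) (L4 ^+ 2 * J8).
  by rewrite -T4 mulrAC I8 mul1r; exact: eqm_refl.
rewrite e1 e2 e4.
have -> : L4 ^+ 5 * J1 ^+ 2 * J2 * J8 ^+ 2 * (L1 ^+ 2 * J2 * (L2 ^+ 2 * J4))
  = (L4 ^+ 2 * J8) ^+ 2 * (L1 * J1) ^+ 2 * (L2 * J2) ^+ 2 * (L4 * J4) by ring.
by rewrite I1 I2 I4 !expr1n !mulr1; exact: eqm_refl.
Qed.

Lemma eqm_addMn M n p q r : p = q + M%:R * r -> eqm M n p q.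
Proof. by move=> ->; exists r, 0; ring. Qed.

Lemma g2_mod8 N :
  let S := theta_half N in
  eqm 8 N.+1 (g2_trunc N)
    (1 + 6 * S 1%N + 4 * (S 1%N * S 1%N) + 6 * S 2 + 4 * (S 2 * S 2)
     + 4 * S 4 + 4 * (S 4 * S 4) + 4 * (S 1%N * S 2)).
Proof.
move=> S; have := eqm0 8 _ _ _ (g2_theta N).
rewrite /= -/(g2_trunc N) -/(S 1%N) -/(S 2) -/(S 4).
move: (g2_trunc N) (S 1%N) (S 2) (S 4) => G A B C GE.
have p4 (x : {poly int}) : eqm 8 N.+1 ((1 + 2 * x) ^+ 4) 1.
  by apply: (eqm_addMn _ _ _ _ (x + 3 * x ^+ 2 + 4 * x ^+ 3 + 2 * x ^+ 4)); ring.
(* Fourth powers being 1 modulo 8, division by [F 1 * F 2] becomes multiplication by its cube. *)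
have -> : eqm 8 N.+1 G (G * ((1 + 2 * A) ^+ 4 * (1 + 2 * B) ^+ 4)).
  by rewrite !p4 !mulr1; exact: eqm_refl.
have -> : G * ((1 + 2 * A) ^+ 4 * (1 + 2 * B) ^+ 4)
  = G * ((1 + 2 * A) * (1 + 2 * B)) * ((1 + 2 * A) ^+ 3 * (1 + 2 * B) ^+ 3) by ring.
rewrite GE.
have p3 (x : {poly int}) : eqm 8 N.+1 ((1 + 2 * x) ^+ 3) (1 + 2 * (3 * x + 2 * x ^+ 2)).
  by apply: (eqm_addMn _ _ _ _ (x ^+ 2 + x ^+ 3)); ring.
rewrite !p3.
(* The witness collects the multiples of 8 in the expansion, with [(1 + 2C)^2 = 1 + 4(C + C^2)] and
   [36 AB = 4 AB + 32 AB]. *)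
apply: (eqm_addMn _ _ _ _ ((C + C ^+ 2) * (3 * A + 2 * A ^+ 2 + (3 * B + 2 * B ^+ 2)
   + 2 * ((3 * A + 2 * A ^+ 2) * (3 * B + 2 * B ^+ 2)))
   + (4 * A * B + 3 * A * B ^+ 2 + 3 * A ^+ 2 * B + 2 * A ^+ 2 * B ^+ 2))).
ring.
Qed.

(** * Products and psi modulo 2 *)

Lemma psi_sum_sqr d K n : eqm 2 n (psi_sum _ 'X^(2 * d) K) (psi_sum _ 'X^d K ^+ 2).
Proof.
rewrite /psi_sum; elim/big_rec2: _ => [|m x y _ xy].
  by rewrite expr0n; exact: eqm_refl.
rewrite xy; apply: (eqm_addMn _ _ _ _ (- ('X^d ^+ (m * m.+1)./2 * x))).
rewrite (_ : 'X^(2 * d) ^+ _ = ('X^d ^+ (m * m.+1)./2) ^+ 2); first by ring.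
by rewrite mulnC exprM exprAC.
Qed.

Lemma ell_sqr_mod2 d n N : eqm 2 n (ell_trunc (2 * d) N) (ell_trunc d N ^+ 2).
Proof.
rewrite /ell_trunc; elim/big_rec2: _ => [|m x y _ xy].
  by rewrite expr1n; exact: eqm_refl.
rewrite xy -mulnA [(2 * _)%N]mulnC exprM.
by apply: (eqm_addMn _ _ _ _ (x ^+ 2 * ('X^(d * m) - 'X^(d * m) ^+ 2))); ring.
Qed.

Lemma ell1ell8_psi N :
  eqm 2 N.+1 (ell_trunc 1 N * ell_trunc 8 N)
    (psi_sum _ 'X^1 N.+1.*2 * psi_sum _ 'X^2 N.+1.*2).
Proof.
have I1 := eqm0 2 _ _ _ (@ell_mul_inv 1 N isT).
have E2 : eqm 2 N.+1 (ell_trunc 2 N) (ell_trunc 1 N ^+ 2) := ell_sqr_mod2 1 N.+1 N.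
have E4 : eqm 2 N.+1 (ell_trunc 4 N) (ell_trunc 2 N ^+ 2) := ell_sqr_mod2 2 N.+1 N.
have E8 : eqm 2 N.+1 (ell_trunc 8 N) (ell_trunc 4 N ^+ 2) := ell_sqr_mod2 4 N.+1 N.
have P : eqm 2 N.+1 (ell_trunc 1 N * psi_sum _ 'X^1 N.+1.*2) (ell_trunc 2 N ^+ 2).
  exact/eqm0/(@ell_psi 1 N isT).
rewrite (psi_sum_sqr 1) E8 E4 E2; rewrite E2 in P; clear E2 E4 E8.
move: (ell_trunc 1 N) (ell_inv_trunc 1 N) (psi_sum _ _ _) I1 P => L J U I1 P.
have -> : eqm 2 N.+1 U (L ^+ 3).
  have -> : eqm 2 N.+1 U (L * U * J).
    by rewrite mulrAC I1 mul1r; exact: eqm_refl.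
  rewrite P (_ : _ * J = L ^+ 3 * (L * J)); last by ring.
  by rewrite I1 mulr1; exact: eqm_refl.
by rewrite (_ : L * _ = L ^+ 3 * (L ^+ 3) ^+ 2); [exact: eqm_refl | ring].
Qed.

(** * Coefficients as counts of representations *)

Lemma theta_halfE N d :
  theta_half N d = \sum_(1 <= j < N.+1) ((-1) ^+ j)%:P * 'X^(d * j ^ 2).
Proof.
by apply: eq_bigr => j _; rewrite -exprM; congr (_ * _); rewrite rmorphXn rmorphN1.
Qed.

Lemma coef_theta_half N d M :
  (theta_half N d)`_M = \sum_(1 <= j < N.+1) (-1) ^+ j * (d * j ^ 2 == M)%N%:R.
Proof.
rewrite theta_halfE coef_sum; apply: eq_bigr => j _.
by rewrite coefCM coefXn eq_sym.
Qed.

Lemma coef_theta_halfM N d e M :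
  (theta_half N d * theta_half N e)`_M
  = \sum_(1 <= i < N.+1) \sum_(1 <= j < N.+1)
      (-1) ^+ (i + j) * (d * i ^ 2 + e * j ^ 2 == M)%N%:R.
Proof.
rewrite !theta_halfE big_distrlr coef_sum /=; apply: eq_bigr => i _.
rewrite coef_sum; apply: eq_bigr => j _.
by rewrite mulrACA -polyCM -!exprD coefCM coefXn eq_sym.
Qed.

Lemma sqrn_mod8 j : (j ^ 2 %% 4 = odd j /\ (odd j -> j ^ 2 %% 8 = 1))%N.
Proof.
have := mulnn j; have := odd_double_half j; have := odd_double_half j./2.
case: (odd j) => /=; case: (odd j./2) => /=; split=> //; nia.
Qed.

Lemma coef_theta_half_eq0 N d M :
  (forall j, (d * j ^ 2)%N <> M) -> (theta_half N d)`_M = 0.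
Proof.
move=> H; rewrite coef_theta_half big1 // => j _.
by case: eqP => [/H//|_]; rewrite mulr0.
Qed.

Lemma coef_theta_halfM_eq0 N d e M :
  (forall i j, (d * i ^ 2 + e * j ^ 2)%N <> M) -> (theta_half N d * theta_half N e)`_M = 0.
Proof.
move=> H; rewrite coef_theta_halfM big1 // => i _; rewrite big1 // => j _.
by case: eqP => [/H//|_]; rewrite mulr0.
Qed.

(** Solutions are counted over nonnegative integers, to match the one-sided theta sums; the bound
    [M] misses none. *)
Definition squares M := (\sum_(0 <= y < M.+1) (y ^ 2 == M))%N.
Definition reps M :=
  (\sum_(0 <= x < M.+1) \sum_(0 <= y < M.+1) (x ^ 2 + 2 * y ^ 2 == M))%N.

Lemma g2_coef N :
  let S d := (theta_half N d)`_N in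
  let SS d e := (theta_half N d * theta_half N e)`_N in
  (g2 N = (N == 0)%N%:R + 6 * S 1%N + 4 * SS 1%N 1%N + 6 * S 2%N
     + 4 * SS 2%N 2%N + 4 * S 4%N + 4 * SS 4%N 4%N + 4 * SS 1%N 2%N %[mod 8])%Z.
Proof.
have := eqm_coef _ _ _ _ N (g2_mod8 N) (ltnSn N).
have coefMnat (k : nat) (p : {poly int}) : (k%:R * p)`_N = k%:Z * p`_N.
  by rewrite mulr_natl coefMn -mulr_natl natz.
by rewrite !coefD coef1 !coefMnat /g2 -/(g2_trunc N).
Qed.

(** Squares are 0, 1 or 4 modulo 8, so 3 modulo 8 is none of [d j^2] and [d (i^2 + j^2)] for [d] in
    {1, 2, 4}; only [x^2 + 2 y^2] remains. *)
Lemma g2_mod8_reps N : (N %% 8 = 3)%N -> (g2 N = 4 * (reps N)%:Z %[mod 8])%Z.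
Proof.
move=> N3; rewrite g2_coef.
rewrite !coef_theta_half_eq0 => [|j|j|j]; try by have := sqrn_mod8 j; lia.
rewrite (coef_theta_halfM_eq0 _ 1 1) => [|i j]; last first.
  by have := sqrn_mod8 i; have := sqrn_mod8 j; lia.
rewrite (coef_theta_halfM_eq0 _ 2 2) => [|i j]; last first.
  by have := sqrn_mod8 i; have := sqrn_mod8 j; lia.
rewrite (coef_theta_halfM_eq0 _ 4 4) => [|i j]; last first.
  by have := sqrn_mod8 i; have := sqrn_mod8 j; lia.
rewrite (_ : (N == 0)%N = false) ?mulr0 ?addr0 ?add0r; last by lia.
congr (4 * _ %% 8)%Z.
(* [reps] starts at 0 and the theta sums at 1: zero values of [x] or [y] give no solution when [N]
   is 3 modulo 8. *)
rewrite coef_theta_halfM /reps [in RHS]big_ltn // [X in (X + _)%N]big1 => [|y _]; last first.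
  by case: eqP => //; have := sqrn_mod8 y; lia.
rewrite add0n -natz natr_sum; apply: eq_bigr => x _.
rewrite [in RHS]big_ltn // (_ : (_ == N) = false) ?add0n; last first.
  by apply/eqP; have := sqrn_mod8 x; lia.
rewrite natr_sum; apply: eq_bigr => y _; rewrite mul1n.
case: eqP => [E|_]; last by rewrite mulr0.
(* Both [x] and [y] are odd, so the sign is +1. *)
rewrite -signr_odd (_ : odd _ = false) ?mul1r //.
by have := sqrn_mod8 x; have := sqrn_mod8 y; lia.
Qed.

Lemma sum_nat_bound (F : nat -> nat) K K' :
  (K <= K')%N -> (forall y, (K <= y)%N -> F y = 0%N) ->
  (\sum_(0 <= y < K') F y = \sum_(0 <= y < K) F y)%N.
Proof.
move=> le F0; rewrite (big_cat_nat (n := K)) //= [X in (_ + X)%N]big_nat_cond.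
by rewrite [X in (_ + X)%N]big1 ?addn0 // => y /andP[/andP[/F0]].
Qed.

(** Restricts a count to one residue class: odd numbers, or multiples of a prime. The range has to
    be a multiple of [p], hence the shape of the bounds chosen in the counts below. *)
Lemma sum_nat_stride (F : nat -> nat) p c K : (c < p)%N ->
  (forall y, (y %% p)%N <> c -> F y = 0%N) ->
  (\sum_(0 <= y < p * K) F y = \sum_(0 <= a < K) F (p * a + c))%N.
Proof.
move=> lt_cp F0; elim: K => [|K IHK]; first by rewrite muln0 !big_geq.
rewrite (big_cat_nat (n := (p * K)%N)) //=; last by lia.
rewrite IHK big_nat_recr //=; congr addn.
rewrite -{1}[(p * K)%N]add0n big_addn mulnS addnK big_mkord.
rewrite (bigD1 (Ordinal lt_cp)) //= big1 ?addn0 1?addnC // => i /eqP ne.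
by apply: F0; rewrite addnC mulnC modnMDl modn_small // => e; apply: ne; exact: val_inj.
Qed.

Lemma squares_bound K M : (M < K)%N -> (\sum_(0 <= y < K) (y ^ 2 == M))%N = squares M.
Proof. by move=> lt_MK; apply: sum_nat_bound => // y lt_My; case: eqP => //; nia. Qed.

Lemma reps_bound K M : (M < K)%N ->
  (\sum_(0 <= x < K) \sum_(0 <= y < K) (x ^ 2 + 2 * y ^ 2 == M))%N = reps M.
Proof.
move=> lt_MK; rewrite (sum_nat_bound _ M.+1) // => [|x lt_Mx]; last first.
  by rewrite big1 // => y _; case: eqP => //; nia.
apply: eq_bigr => x _; apply: sum_nat_bound => // y lt_My.
by case: eqP => //; nia.
Qed.

(** Since [2 * M] is 2 modulo 4, it is not a square. In [2 j^2 = 2 M] the number [j] is odd, so the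
    coefficient is [- squares M], and [-6] is 2 modulo 4. *)
Lemma g2_mod4_squares M : odd M -> (g2 (2 * M) = 2 * (squares M)%:Z %[mod 4])%Z.
Proof.
move=> Modd; have := g2_coef (2 * M); lazy zeta beta.
rewrite (coef_theta_half_eq0 _ 1) => [|j]; last by have := sqrn_mod8 j; lia.
have -> : (2 * M == 0)%N = false by lia.
have e : ((theta_half (2 * M) 2)`_(2 * M) = - (squares M)%:Z).
  rewrite coef_theta_half -(squares_bound (2 * M).+1); last by lia.
  rewrite [in RHS]big_ltn // (_ : (0 ^ 2 == M)%N = false) ?add0n; last by lia.
  rewrite -natz natr_sum -sumrN; apply: eq_bigr => y _; rewrite eqn_pmul2l //.
  case: eqP => [E|_]; last by rewrite mulr0 oppr0.
  by rewrite -signr_odd (_ : odd y = true) ?mulr1 //; have := sqrn_mod8 y; lia.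
rewrite e; lia.
Qed.


(** [(2m+1)^2 = 8 m(m+1)/2 + 1], and a root of an odd square is odd. *)
Lemma squares_psi n : (squares (8 * n + 1))%:Z = psi_coef n.
Proof.
rewrite /psi_coef -(squares_bound (2 * (4 * n + 1))); last by lia.
rewrite (sum_nat_stride _ 2 1) // => [|y]; last by case: eqP => //; have := sqrn_mod8 y; lia.
rewrite -(big_mkord xpredT (fun m => ((m * m.+1)./2 == n) : nat)).
rewrite (sum_nat_bound _ n.+1) => [||y le]; [|by lia|by case: eqP => //; nia].
congr Posz; apply: eq_bigr => m _; congr nat_of_bool.
have := odd_double_half (m * m.+1); rewrite oddM oddS andbN add0n => E.
by apply/eqP/eqP; nia.
Qed.

(** * Effect of prime factors on the counts *)

Lemma prime_dvd_sqr p y : prime p -> (p %| y ^ 2 -> p %| y)%N.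
Proof. by move=> pp; rewrite Euclid_dvdX // => /andP[]. Qed.

Lemma squares_sqr_mul p M : prime p -> squares (p ^ 2 * M) = squares M.
Proof.
move=> pp; have p0 := prime_gt0 pp.
rewrite -(squares_bound (p * (p * M).+1)); last by nia.
rewrite (sum_nat_stride _ p 0) // => [|y /eqP ndvd]; last first.
  case: eqP => // E; case/negP: ndvd; apply: (prime_dvd_sqr _ _ pp).
  by rewrite E -mulnn -mulnA dvdn_mulr.
rewrite -(squares_bound (p * M).+1); last by nia.
apply: eq_bigr => a _; rewrite addn0 expnMn eqn_pmul2l // expn_gt0 p0 //.
Qed.

Lemma squares_prime_mul p M : prime p -> ~~ (p %| M)%N -> squares (p * M) = 0%N.
Proof.
move=> pp ndvd; apply: big1 => y _; case: eqP => // E.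
have p0 := prime_gt0 pp.
have /dvdnP[k yE] : (p %| y)%N by apply: prime_dvd_sqr => //; rewrite E dvdn_mulr.
case/negP: ndvd; rewrite -(@dvdn_pmul2l p) // -E yE expnMn mulnn dvdn_mull //.
Qed.

(* For an odd prime: -2 is not a square modulo [p]. *)
Definition inert p := forall x y, (p %| x ^ 2 + 2 * y ^ 2 -> (p %| x) && (p %| y))%N.

(** Inertness makes [(a, b) -> (p a, p b)] a bijection between the solutions for [M] and those for
    [p^2 M]. *)
Lemma reps_sqr_mul p M : prime p -> inert p -> reps (p ^ 2 * M) = reps M.
Proof.
move=> pp pI; have p0 := prime_gt0 pp.
rewrite -(reps_bound (p * (p * M).+1)); last by nia.
have H x y : (x ^ 2 + 2 * y ^ 2 = p ^ 2 * M)%N -> (p %| x)%N && (p %| y)%N.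
  by move=> E; apply: pI; rewrite E -mulnn -mulnA dvdn_mulr.
rewrite (sum_nat_stride _ p 0) // => [|x /eqP ndvd]; last first.
  by rewrite big1 // => y _; case: eqP => // /H /andP[dx _]; case/negP: ndvd.
rewrite -(reps_bound (p * M).+1); last by nia.
apply: eq_bigr => a _.
rewrite (sum_nat_stride _ p 0) // => [|y /eqP ndvd]; last first.
  by case: eqP => // /H /andP[_ dy]; case/negP: ndvd.
apply: eq_bigr => b _; rewrite !addn0 !expnMn mulnCA -mulnDr eqn_pmul2l //.
by rewrite expn_gt0 p0.
Qed.

(** A solution would have both entries divisible by [p], so [p^2] would divide [p M]. *)
Lemma reps_prime_mul p M : prime p -> inert p -> ~~ (p %| M)%N -> reps (p * M) = 0%N.
Proof.
move=> pp pI ndvd; apply: big1 => x _; apply: big1 => y _; case: eqP => // E.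
have p0 := prime_gt0 pp.
have /andP[/dvdnP[k xE] /dvdnP[l yE]] : (p %| x)%N && (p %| y)%N.
  by apply: pI; rewrite E dvdn_mulr.
case/negP: ndvd; rewrite -(@dvdn_pmul2l p) // -E xE yE !expnMn mulnn mulnA -mulnDl.
by rewrite dvdn_mull.
Qed.

(** * Triangular numbers and l_1 l_8 *)

(** Both entries are odd: with [x = 2a+1] and [y = 2b+1], [x^2 + 2 y^2 = 8 (T_a + 2 T_b) + 3], where
    [T_m = m(m+1)/2]. The free bound [K] is later matched to the truncation of [psi_sum]. *)
Lemma reps_triangular n K : (2 * n.+1 <= K)%N ->
  reps (8 * n + 3) =
  (\sum_(0 <= a < K) \sum_(0 <= b < K) ((a * a.+1)./2 + 2 * (b * b.+1)./2 == n))%N.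
Proof.
move=> le_nK.
rewrite -(reps_bound (2 * (K + 4 * n + 2))); last by lia.
rewrite (sum_nat_stride _ 2 1) // => [|x odd_x]; last first.
  by rewrite big1 // => y _; case: eqP => //; have := sqrn_mod8 x; lia.
have tri m : (m * m.+1)./2.*2 = (m * m.+1)%N.
  by have := odd_double_half (m * m.+1); rewrite oddM oddS andbN add0n.
rewrite (sum_nat_bound _ K) => [||x le]; first last.
- by rewrite big1 // => y _; case: eqP => //; nia.
- by lia.
apply: eq_bigr => a _.
rewrite (sum_nat_stride _ 2 1) // => [|y odd_y]; last first.
  by case: eqP => //; have := sqrn_mod8 (2 * a + 1); have := sqrn_mod8 y; lia.
rewrite (sum_nat_bound _ K) => [||y le]; first last.
- by case: eqP => //; nia.
- by lia.
apply: eq_bigr => b _; congr nat_of_bool.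
by move: (tri a) (tri b) => ta tb; apply/eqP/eqP; nia.
Qed.

Lemma ell1ell8_reps n : (ell1ell8_coef n = (reps (8 * n + 3))%:Z %[mod 2])%Z.
Proof.
rewrite /ell1ell8_coef (eqm_coef _ _ _ _ _ (ell1ell8_psi n)) //.
congr (_ %% 2)%Z; rewrite /psi_sum big_distrlr coef_sum /= (reps_triangular _ n.+1.*2); last by lia.
rewrite -natz natr_sum; apply: eq_bigr => a _.
rewrite coef_sum natr_sum; apply: eq_bigr => b _.
by rewrite -!exprM mul1n -exprD coefXn eq_sym.
Qed.

(** * Inert primes from the Legendre symbol *)

(** If [p] did not divide [y], with inverse [u] modulo [p], then [(2 x u)^2 = -8 (y u)^2 = -8]
    modulo [p], against the symbol. So [p] divides [y], hence [x^2] and [x]. *)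
Lemma legendre_inert p : prime p -> (2 < p)%N -> legendre (-8) p = -1 -> inert p.
Proof.
move=> pp p_gt2; rewrite /legendre; case: ifP => // _; case: ifP => // /existsP nres _ x y dvd_xy.
have p0 := prime_gt0 pp.
have dvd_y : (p %| y)%N.
  apply/negPn/negP => ndvd; case: nres.
  have /coprimeP : coprime y p by rewrite coprime_sym prime_coprime.
  case=> [|[u v] /= uv]; first by case: (y) ndvd; rewrite ?dvdn0.
  pose w := ((2 * x * u) %% p)%N.
  have lt_wp : (w < p)%N by rewrite ltn_pmod.
  exists (Ordinal lt_wp).
  have [k wE] : exists k : int, w%:Z = (2 * x * u)%:Z - k * p%:Z.
    by exists ((2 * x * u) %/ p)%N; have := divn_eq (2 * x * u) p; rewrite -/w; lia.
  have [l xyE] : exists l : int, x%:Z ^+ 2 + 2 * y%:Z ^+ 2 = l * p%:Z.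
    by case/dvdnP: dvd_xy => l E; exists l%:Z; lia.
  have uvE : u%:Z * y%:Z = 1 + v%:Z * p%:Z by lia.
  (* The quotient of [w^2 + 8] by [p], from [w = 2xu - kp], [x^2 = lp - 2y^2] and [uy = 1 + vp]. *)
  apply/eqP/dvdz_mod0P/dvdzP; exists (4 * u%:Z ^+ 2 * l - 2 * k * (2 * x%:Z * u%:Z) + k ^+ 2 * p%:Z
     - 8 * v%:Z * (2 + v%:Z * p%:Z)).
  have xE : x%:Z ^+ 2 = l * p%:Z - 2 * y%:Z ^+ 2 by rewrite -xyE; ring.
  rewrite [X in X ^+ 2 - _]wE !PoszM.
  rewrite (_ : _ - -8 = 4 * u%:Z ^+ 2 * (x%:Z ^+ 2)
    - k * p%:Z * (4 * x%:Z * u%:Z - k * p%:Z) + 8); last by ring.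
  rewrite xE (_ : _ + 8 = 4 * u%:Z ^+ 2 * l * p%:Z - 8 * (u%:Z * y%:Z) ^+ 2
    - k * p%:Z * (4 * x%:Z * u%:Z - k * p%:Z) + 8); last by ring.
  by rewrite uvE; ring.
rewrite dvd_y andbT; apply: prime_dvd_sqr => //.
by move: dvd_xy; rewrite dvdn_addl // dvdn_mull // -mulnn dvdn_mulr.
Qed.

(** * Even powers of p and the final congruences *)

Lemma squares_expn_mul p a M : prime p -> squares (p ^ (2 * a) * M) = squares M.
Proof.
move=> pp; elim: a => [|a IH]; first by rewrite muln0 mul1n.
by rewrite mulnS expnD -mulnA squares_sqr_mul.
Qed.

Lemma reps_expn_mul p a M : prime p -> inert p -> reps (p ^ (2 * a) * M) = reps M.
Proof.
move=> pp pI; elim: a => [|a IH]; first by rewrite muln0 mul1n.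
by rewrite mulnS expnD -mulnA reps_sqr_mul.
Qed.

Lemma modz_mul4_mod8 x y : (x = y %[mod 2])%Z -> (4 * x = 4 * y %[mod 8])%Z.
Proof. lia. Qed.

Lemma odd_sqr_expn_mod8 p a : odd p -> (p ^ (2 * a) %% 8 = 1)%N.
Proof. by move=> op; rewrite mulnC expnM; apply: (sqrn_mod8 _).2; rewrite oddX op orbT. Qed.

Theorem theorem2 :
  forall (alpha : nat),
  (forall p : nat, prime p -> (3 <= p)%N ->
     (forall n : nat,
        (g2 (16 * p ^ (2 * alpha) * n + 2 * p ^ (2 * alpha))%N
           = 2 * psi_coef n %[mod 4])%Z)
     /\ (forall j : nat, (1 <= j <= p - 1)%N -> forall n : nat,
        (g2 (16 * p ^ (2 * alpha + 2) * n + 16 * p ^ (2 * alpha + 1) * j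
               + 2 * p ^ (2 * alpha + 2))%N = 0 %[mod 4])%Z))
  /\
  (forall p : nat, prime p -> (5 <= p)%N -> legendre (-8) p = -1 ->
     (forall n : nat,
        (g2 (8 * p ^ (2 * alpha) * n + 3 * p ^ (2 * alpha))%N
           = 4 * ell1ell8_coef n %[mod 8])%Z)
     /\ (forall j : nat, (1 <= j <= p - 1)%N -> forall n : nat,
        (g2 (8 * p ^ (2 * alpha + 2) * n + 8 * p ^ (2 * alpha + 1) * j
               + 3 * p ^ (2 * alpha + 2))%N = 0 %[mod 8])%Z)).
Proof.
(* Modulo [p] this number is [8 j], nonzero because [p] is odd and [0 < j < p]; [c] will be 1 or
   3. *)
have ndvd p c n j : prime p -> (2 < p)%N -> (1 <= j <= p - 1)%N ->
    ~~ (p %| 8 * (p * n) + 8 * j + c * p)%N.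
  move=> pp p_gt2 j_bd; rewrite dvdn_addl ?dvdn_mull // dvdn_addr; last first.
    by rewrite mulnCA dvdn_mulr.
  rewrite Euclid_dvdM // negb_or -[8%N]/(2 ^ 3)%N Euclid_dvdX // andbT.
  by rewrite !gtnNdvd //; lia.
move=> alpha; split=> p pp p_ge.
  have podd : odd p by case: (even_prime pp) => // p2; move: p_ge; rewrite p2.
  have q1 := odd_sqr_expn_mod8 p alpha podd.
  split=> [n|j j_bd n].
    rewrite (_ : (_ + _)%N = (2 * (p ^ (2 * alpha) * (8 * n + 1)))%N); last by nia.
    rewrite g2_mod4_squares; last by rewrite oddM oddX podd orbT; lia.
    by rewrite squares_expn_mul // squares_psi.
  (* Half the argument contains [p] to the exact odd power [2 * alpha + 1], so it is not a
     square. *)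
  rewrite (_ : (_ + _)%N =
    (2 * (p ^ (2 * alpha) * (p * (8 * (p * n) + 8 * j + 1 * p))))%N); last first.
    by rewrite !expnD; nia.
  rewrite g2_mod4_squares; last first.
    by rewrite !oddM oddX podd orbT; lia.
  by rewrite squares_expn_mul // squares_prime_mul ?mulr0 // ndvd.
move=> leg; have pI : inert p by apply: legendre_inert => //; lia.
have podd : odd p by case: (even_prime pp) => // p2; move: p_ge; rewrite p2.
have q1 := odd_sqr_expn_mod8 p alpha podd.
split=> [n|j j_bd n].
  rewrite (_ : (_ + _)%N = (p ^ (2 * alpha) * (8 * n + 3))%N); last by nia.
  (* Even powers of [p] are 1 modulo 8, which preserves the residue 3. *)
  rewrite g2_mod8_reps; last by rewrite -modnMm q1; lia.
  rewrite reps_expn_mul //; apply: modz_mul4_mod8; exact/esym/ell1ell8_reps.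
rewrite (_ : (_ + _)%N =
    (p ^ (2 * alpha) * (p * (8 * (p * n) + 8 * j + 3 * p)))%N); last first.
  by rewrite !expnD; nia.
(* The residue is that of [3 p^2], again 3 modulo 8. *)
rewrite g2_mod8_reps; last first.
  rewrite -modnMm q1 mul1n modn_mod mulnDr mulnCA.
  have := (sqrn_mod8 p).2 podd; nia.
by rewrite reps_expn_mul // reps_prime_mul ?mulr0 // ndvd //; lia.
Qed.
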